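(* Let $\phi$ be a $\mathsf c$-convex potential of $\mathsf c$-Legendre type of the cost $\mathsf c$ on $\mathcal N\subset\Omega\times\bar\Omega\subset\mathbb R^n\times\mathbb R^n$, with optimal map $\mathbf T=\mathbf T_\phi$ (write $x_{\mathbf T}=\mathbf T(x)$), and let $\mathfrak D[x:x']=\mathsf c(x,x'_{\mathbf T})+\phi(x)-\mathsf c(x',x'_{\mathbf T})-\phi(x')$ be the $\mathsf c$-divergence. On $\hat{\mathcal N}=\{(x,x')\in\Omega\times\Omega:(x,x'_{\mathbf T})\in\mathcal N\}$ (assumed open) with the Kim-McCann metric $KM_{\mathfrak D}$ of the cost $\mathfrak D$, denote the two components of the Levi-Civita connection by $\nabla^1$ and $\nabla^{-1}$, and their Christoffel functions by $\Gamma^1$ and $\Gamma^{-1}$. On the diagonal, they are the pair of dualistic connections (the primal and dual connections) of the divergence $\mathfrak D$, and $$\Gamma^1(x,x;\xi_1,\xi_2)=\big((D\bar{\mathcal D}\mathsf c)^{-1}D_{\xi_1}D_{\xi_2}\bar{\mathcal D}\mathsf c\big)(x,x_{\mathbf T}).$$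
   Context: $\Omega,\bar\Omega\subset\mathbb R^n$ are domains. $D,\bar D$ are directional derivatives and $\mathcal D,\bar{\mathcal D}$ gradients (standard inner product) in the first and second variable of the cost; $D\bar{\mathcal D}\mathsf c$ is the operator $\omega\mapsto D_\omega\bar{\mathcal D}\mathsf c$. The cost is sufficiently smooth and satisfies: (A1) for each $x$, $\bar x\mapsto-D\mathsf c(x,\bar x)$ is injective on $\{\bar x:(x,\bar x)\in\mathcal N\}$; (A2) $(\xi,\bar\xi)\mapsto\bar D_{\bar\xi}D_\xi\mathsf c$ is nondegenerate. The Kim-McCann metric of a cost is $\langle(\omega_1,\bar\omega_1),(\omega_2,\bar\omega_2)\rangle_{KM}=-\frac12(D_{\omega_1}\bar D_{\bar\omega_2}\mathsf c+\bar D_{\bar\omega_1}D_{\omega_2}\mathsf c)$. The Christoffel function $\Gamma$ of a connection is defined by $\nabla_{\mathtt X}\mathtt Y=D_{\mathtt X}\mathtt Y+\Gamma(\mathtt X,\mathtt Y)$; for a Kim-McCann metric, the Levi-Civita Christoffel function of $((\xi_1,\xi_1'),(\xi_2,\xi_2'))$ has a first component depending only on $\xi_1,\xi_2$ and a second component depending only on $\xi_1',\xi_2'$; these components, for $KM_{\mathfrak D}$, are $\Gamma^1(x,x';\xi_1,\xi_2)$ and $\Gamma^{-1}(x,x';\xi_1',\xi_2')$. Transforms: $\phi^{\bar{\mathsf c}}(\bar x)=\sup_x(-\mathsf c(x,\bar x)-\phi(x))$, $\psi^{\mathsf c}(x)=\sup_{\bar x}(-\mathsf c(x,\bar x)-\psi(\bar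 x))$; $\phi$ is $\mathsf c$-convex if $\phi=\psi^{\mathsf c}$ for some $\psi$. For $\mathsf c$-convex $\phi$ such that for each $\bar x\in\bar\Omega$ the maximum of $x\mapsto-\mathsf c(x,\bar x)-\phi(x)$ is attained at a unique interior point of $\Omega$, the optimal map $\mathbf T_\phi$ is the inverse (assumed well defined) of the map sending $\bar x$ to that point; it satisfies $\mathcal D\mathsf c(x,x_{\mathbf T})+\mathrm{grad}_\phi(x)=0$. The $\mathsf c$-Hessian is $\mathrm{hess}^{\mathsf c}_\phi(x)\xi=(D_\xi\mathcal D\mathsf c)(x,x_{\mathbf T})+\mathrm{hess}_\phi(x)\xi$ ($x_{\mathbf T}$ held fixed). $\phi$ is of $\mathsf c$-Legendre type if $\mathbf T_\phi$ is a diffeomorphism between $\Omega$ and $\bar\Omega$ and $\mathrm{hess}^{\mathsf c}_\phi(x)$ is positive definite. For a divergence $\mathfrak D[x:x']$, with $D'$ the derivative in $x'$, the divergence metric is $g(\xi,\eta)=-(D_\xi D'_\eta\mathfrak D)|_{x'=x}$, and the dualistic pair of connections consists of the primal connection with Christoffel function $\Gamma^1$ determined by $g(\Gamma^1(\xi_1,\xi_2),\xi_3)=-(D_{\xi_1}D_{\xi_2}D'_{\xi_3}\mathfrak D)|_{x'=x}$ and the dual connection determined by $g(\Gamma^{-1}(\xi_1,\xi_2),\xi_3)=-(D'_{\xi_1}D'_{\xi_2}D_{\xi_3}\mathfrak D)|_{x'=x}$. *)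

(* Defs.v *)
From mathcomp Require Import all_boot all_order all_algebra.
From mathcomp Require Import all_classical all_reals all_analysis.

Set Implicit Arguments.
Unset Strict Implicit.
Unset Printing Implicit Defensive.

Import Order.TTheory GRing.Theory Num.Theory.
Import numFieldNormedType.Exports.

Local Open Scope classical_set_scope.
Local Open Scope ring_scope.

Section Calculus.
Context {R : realType}.

Definition domain {V : normedModType R} (U : set V) :=
  [/\ open U, connected U & U !=set0].

(* Class C^k on an open set U; the spaces V in use are finite-dimensional, so
   that it suffices to control the derivatives along each fixed direction. *)
Fixpoint Ck {V W : normedModType R} (k : nat) (U : set V) (f : V -> W) : Prop :=
  match k with
  | 0%N => forall p, U p -> {for p, continuous f}
  | k'.+1 => (forall p, U p -> differentiable f p) /\
             (forall v, Ck k' U ('D_v f))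
  end.

Definition Ck_diffeo {V W : normedModType R} (k : nat) (A : set V) (B : set W)
    (f : V -> W) := exists g : W -> V,
  [/\ forall x, A x -> B (f x) /\ g (f x) = x,
      forall y, B y -> A (g y) /\ f (g y) = y,
      Ck k A f & Ck k B g].

(* Derivatives in the first and in the second variable. *)
Definition D1 {V W Z : normedModType R} (v : V) (f : V -> W -> Z) : V -> W -> Z :=
  fun x y => 'D_v (fun z => f z y) x.

Definition D2 {V W Z : normedModType R} (w : W) (f : V -> W -> Z) : V -> W -> Z :=
  fun x y => 'D_w (f x) y.

End Calculus.

Section Euclidean.
Context {R : realType} {n : nat}.
Notation E := 'rV[R]_n.

Definition dot (u v : E) : R := \sum_i u 0 i * v 0 i.

Definition grad (f : E -> R) : E -> E :=
  fun x => \row_i 'D_(delta_mx 0 i) f x.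

Definition grad1 (f : E -> E -> R) : E -> E -> E :=
  fun x y => grad (fun z => f z y) x.

Definition grad2 (f : E -> E -> R) : E -> E -> E :=
  fun x y => grad (f x) y.

(* Matrix of the operator w |-> D1 w (grad2 f) x y, acting on row vectors by
   right multiplication: w *m cross_mx f x y = D1 w (grad2 f) x y. *)
Definition cross_mx (f : E -> E -> R) (x y : E) : 'M[R]_n :=
  lin1_mx (fun w => D1 w (grad2 f) x y).

End Euclidean.

Section Connections.
Context {R : realType} {V : normedModType R}.

(* A (pseudo-Riemannian) metric on an open subset of V sends a point to a
   bilinear form on V; a connection is given by its Christoffel function. *)
Implicit Types (U : set V) (g : V -> V -> V -> R) (G : V -> V -> V -> V).

Definition covariant_derivative G (X Y : V -> V) : V -> V :=
  fun p => 'D_(X p) Y p + G p (X p) (Y p).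

Definition lie_bracket (X Y : V -> V) : V -> V :=
  fun p => 'D_(X p) Y p - 'D_(Y p) X p.

Definition vector_field U (X : V -> V) := forall p, U p -> differentiable X p.

(* Bilinearity of G is what makes [covariant_derivative G] tensorial in its
   first argument and a derivation in its second one. *)
Definition is_connection U G := forall p, U p ->
  (forall w, linear (fun v => G p v w)) /\ (forall v, linear (G p v)).

Definition torsion_free U G := forall X Y,
  vector_field U X -> vector_field U Y -> forall p, U p ->
  covariant_derivative G X Y p - covariant_derivative G Y X p
  = lie_bracket X Y p.

Definition metric_compatible U g G := forall X Y Z,
  vector_field U X -> vector_field U Y -> vector_field U Z ->
  forall p, U p ->
  'D_(X p) (fun q => g q (Y q) (Z q)) p =
    g p (covariant_derivative G X Y p) (Z p) +
    g p (Y p) (covariant_derivative G X Z p).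

Definition levi_civita U g G :=
  [/\ is_connection U G, torsion_free U G & metric_compatible U g G].

End Connections.

Section Divergence.
Context {R : realType} {n : nat}.
Notation E := 'rV[R]_n.

(* Kim-McCann metric of the cost f, with tangent vectors (w, wbar) : E * E. *)
Definition kim_mccann (f : E -> E -> R) (p u v : E * E) : R :=
  - 2^-1 * (D1 u.1 (D2 v.2 f) p.1 p.2 + D2 u.2 (D1 v.1 f) p.1 p.2).

Definition divergence_metric (Dv : E -> E -> R) (x u v : E) : R :=
  - D1 u (D2 v Dv) x x.

(* In the next two definitions the equivalence says that the vector G u1 u2 is
   determined by the equation: it is its unique solution. *)
Definition primal_christoffel (Dv : E -> E -> R) (x : E) (G : E -> E -> E) :=
  forall u1 u2 v, v = G u1 u2 <->
    forall u3, divergence_metric Dv x v u3 = - D1 u1 (D1 u2 (D2 u3 Dv)) x x.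

Definition dual_christoffel (Dv : E -> E -> R) (x : E) (G : E -> E -> E) :=
  forall u1 u2 v, v = G u1 u2 <->
    forall u3, divergence_metric Dv x v u3 = - D2 u1 (D2 u2 (D1 u3 Dv)) x x.

End Divergence.

Section Cost.
Context {R : realType} {n : nat}.
Notation E := 'rV[R]_n.

(* The cost takes its values in ]-oo, +oo]: a cost only given on N is the one
   equal to +oo outside N, for which the suprema below range over N. *)
Implicit Types (Om Omb : set E) (N : set (E * E)) (c : E -> E -> \bar R).

(* Real-valued version of c, meaningful where c is finite. *)
Definition fcost c : E -> E -> R := fun x y => fine (c x y).

Definition twisted N (c : E -> E -> R) := forall x,
  set_inj [set y | N (x, y)] (fun y => fun w : E => - D1 w c x y).

Definition nondegenerate N (c : E -> E -> R) := forall x y, N (x, y) ->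
  (forall u, (forall v, D2 v (D1 u c) x y = 0) -> u = 0) /\
  (forall v, (forall u, D2 v (D1 u c) x y = 0) -> v = 0).

(* C^3 is the least regularity under which the Kim-McCann metric of c has a
   Christoffel function. *)
Definition admissible_cost Om Omb N c :=
  [/\ forall x y, Om x -> Omb y -> c x y != -oo%E,
      forall x y, N (x, y) -> c x y \is a fin_num,
      Ck 3 N (fun p => fcost c p.1 p.2),
      twisted N (fcost c) &
      nondegenerate N (fcost c)].

Definition cbar_transform Om c (phi : E -> \bar R) : E -> \bar R :=
  fun y => ereal_sup [set (- c x y - phi x)%E | x in Om].

Definition c_transform Omb c (psi : E -> \bar R) : E -> \bar R :=
  fun x => ereal_sup [set (- c x y - psi y)%E | y in Omb].

Definition c_convex Om Omb c (phi : E -> R) := exists psi : E -> \bar R,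
  forall x, Om x -> (phi x)%:E = c_transform Omb c psi x.

Definition maximizer Om c (phi : E -> R) (y x : E) :=
  Om x /\
  (- c x y - (phi x)%:E)%E = cbar_transform Om c (fun z => (phi z)%:E) y.

(* S sends y to the unique maximizer, and T is its inverse. *)
Definition optimal_map Om Omb c (phi : E -> R) (T : E -> E) :=
  exists S : E -> E,
  [/\ forall y, Omb y -> forall x, maximizer Om c phi y x <-> x = S y,
      forall x, Om x -> Omb (T x) /\ S (T x) = x &
      forall y, Omb y -> T (S y) = y].

Definition c_hess c (phi : E -> R) (T : E -> E) (x xi : E) : E :=
  D1 xi (grad1 (fcost c)) x (T x) + 'D_xi (grad phi) x.

(* T is of class C^2 when c is of class C^3, as grad phi = - grad1 c (., T .).
   The graph of T has to lie in N, where c is differentiable. *)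
Definition c_legendre Om Omb N c (phi : E -> R) (T : E -> E) :=
  [/\ Ck 2 Om phi,
      Ck_diffeo 2 Om Omb T,
      forall x, Om x -> N (x, T x) &
      forall x, Om x -> forall xi, xi != 0 -> 0 < dot (c_hess c phi T x xi) xi].

Definition c_divergence c (phi : E -> R) (T : E -> E) (x x' : E) : R :=
  fcost c x (T x') + phi x - fcost c x' (T x') - phi x'.

Definition Nhat Om N (T : E -> E) : set (E * E) :=
  [set p | Om p.1 /\ Om p.2 /\ N (p.1, T p.2)].

End Cost.

(* Main.v *)
Require Import Defs.
From HB Require Import structures.
From mathcomp Require Import all_boot all_order all_algebra.
From mathcomp Require Import all_classical all_reals all_analysis.
From mathcomp Require Import ring lra.

(* The mixed Hessian b(u, w) = D_u D'_w of the divergence at (x, x') is the one of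
   the cost at (x, T x') with w replaced by D_w T x'; it is nondegenerate because
   T is a diffeomorphism. The Kim-McCann metric pairs horizontal with vertical
   vectors through b and vanishes on pairs of the same kind, so that by the
   symmetry of third derivatives its Levi-Civita connection splits, with
     b(G1(u1, u2), w) = D_(u1, 0) b(u2, w), b(u, Gm1(w1, w2)) = D_(0, w1) b(u, w2).
   On the diagonal these are the equations of the primal and of the dual
   connection, except that the dual one has b(Gm1(w1, w2), u) on its left-hand
   side; but b is symmetric there, as one sees by differentiating the first-order
   condition of optimality. As the derivative of T is onto, the first equation can
   be tested on all D_w T x = e_j, which turns it into an equation for c alone. *)

Set Implicit Arguments.
Unset Strict Implicit.
Unset Printing Implicit Defensive.

Import Order.TTheory GRing.Theory Num.Theory.
Import numFieldNormedType.Exports.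

Local Open Scope classical_set_scope.
Local Open Scope ring_scope.

(** * Derivatives and Schwarz's theorem *)

Section Derivatives.
Context {R : realType}.

(** The first-order expansion of [f] at [p] only involves values near [p], so it serves for [g] with
    the same differential. *)
Lemma near_eq_differentiable (V W : normedModType R) (f g : V -> W) (p : V) :
  (\forall q \near p, f q = g q) -> differentiable f p -> differentiable g p.
Proof.
move=> fg df; have fgp : f p = g p by exact: nbhs_singleton fg.
have gE : g \o shift p = cst (g p) + 'd f p +o_ 0 id.
  apply/eqaddoP => e e0.
  have /eqaddoP/(_ e e0) := diff_locally df.
  move: fg; rewrite (near_shift 0) subr0 => fg dfe.
  by apply: filterS2 fg dfe => h /= fgh; rewrite !fctE /= -fgp -fgh.
apply/diff_locallyP; have -> : 'd g p = 'd f p :> (V -> W).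
  by apply: diff_unique => //; exact: diff_continuous.
by split => //; exact: diff_continuous.
Qed.

Lemma deriveD_dir (V W : normedModType R) (f : V -> W) (p : V) (v w : V) :
  differentiable f p -> 'D_(v + w) f p = 'D_v f p + 'D_w f p.
Proof. by move=> df; rewrite !deriveE// linearD. Qed.

Lemma is_diff_line (V : normedModType R) (p v : V) (s : R) :
  is_diff s (fun t : R => p + t *: v) ( *:%R ^~ v).
Proof. by rewrite -[X in is_diff _ _ X]add0r; apply: is_diffD. Qed.

Lemma is_derive_line (V W : normedModType R) (f : V -> W) (p v : V) (s : R) :
  differentiable f (p + s *: v) ->
  is_derive s 1 (fun t : R => f (p + t *: v)) ('D_v f (p + s *: v)).
Proof.
move=> df; pose l (t : R) := p + t *: v.
have dl : is_diff s l ( *:%R ^~ v) by exact: is_diff_line.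
have dfl : differentiable (f \o l) s by apply: differentiable_comp.
apply: DeriveDef; first exact: diff_derivable.
rewrite -[LHS]/('D_1 (f \o l) s) !deriveE//.
by rewrite diff_comp//= diff_val scale1r.
Qed.

End Derivatives.

Section Schwarz.
Context {R : realType} {V : normedModType R}.
Implicit Types (g : V -> R) (p v w : V).

(** Alternating sum of [g] over the corners of the parallelogram at [p] spanned by [t *: v] and
    [t *: w]. *)
Definition second_difference g p v w (t : R) : R :=
  g (p + t *: w + t *: v) - g (p + t *: v) - g (p + t *: w) + g p.

Lemma second_differenceC g p v w t :
  second_difference g p v w t = second_difference g p w v t.
Proof.
by rewrite /second_difference (addrAC p) -!addrA; congr (_ + _); ring.
Qed.

(** The mean value theorem along [v] turns the second difference into [t] times a difference of two
    values of ['D_v g]. Expanding both to first order at [p], the terms along [v] cancel and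
    [t * 'D_w ('D_v g) p] remains. *)
Lemma second_difference_derive g p v w :
  (\forall q \near p, differentiable g q) -> differentiable ('D_v g) p ->
  forall e, 0 < e -> \forall t \near 0^'+,
  `|second_difference g p v w t - t ^+ 2 * 'D_w ('D_v g) p| <= e * t ^+ 2.
Proof.
(* The parallelogram stays within [t * M] of [p], and the [+ 1] keeps [M] positive. Two errors
   [e1 * (t * M)], multiplied by [t], add up to [e * t ^+ 2]. *)
move=> dg ddg e e0; pose M := `|v| + `|w| + 1.
have M0 : 0 < M by rewrite /M ltr_wpDl ?addr_ge0.
pose e1 := e / (2 * M); have e10 : 0 < e1 by rewrite divr_gt0 ?mulr_gt0.
have /eqaddoP/(_ e1 e10)/nbhs_normP[/= d1 d10 H1] := diff_locally ddg.
move: dg; rewrite (near_shift 0) subr0 => /nbhs_normP[/= d2 d20 H2].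
near=> t.
have t0 : 0 < t by near: t; exact: nbhs_right_gt.
have tM1 : t * M < d1.
  by rewrite -ltr_pdivlMr//; near: t; apply: nbhs_right_lt; rewrite divr_gt0.
have tM2 : t * M < d2.
  by rewrite -ltr_pdivlMr//; near: t; apply: nbhs_right_lt; rewrite divr_gt0.
have norm_le (s : R) : 0 <= s <= t ->
    `|t *: w + s *: v| <= t * M /\ `|s *: v| <= t * M.
  move=> /andP[s0 st]; have sv : `|s *: v| <= t * `|v|.
    by rewrite normrZ ger0_norm// ler_wpM2r.
  have tw : `|t *: w| = t * `|w| by rewrite normrZ ger0_norm// ltW.
  split.
    apply: (le_trans (ler_normD _ _)); rewrite tw (le_trans (lerD (lexx _) sv))//.
    by rewrite /M; have := ltW t0; nra.
  apply: (le_trans sv); rewrite ler_wpM2l ?(ltW t0)//.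
  by rewrite /M -addrA lerDl addr_ge0.
have Dg (h : V) : `|h| <= t * M -> differentiable g (p + h).
  move=> hM; rewrite addrC; apply: (H2 h) => /=.
  by rewrite sub0r normrN (le_lt_trans hM).
have DDg (h : V) : `|h| <= t * M ->
    `|'D_v g (p + h) - 'D_v g p - 'd ('D_v g) p h| <= e1 * (t * M).
  move=> hM; have := H1 h; rewrite /= sub0r normrN => /(_ (le_lt_trans hM tM1)).
  rewrite [p + h]addrC opprD addrA => /le_trans; apply.
  by rewrite ler_wpM2l// ltW.
(* The increment of [F] over [[0, t]] is the second difference. *)
pose F (s : R) := g (p + t *: w + s *: v) - g (p + s *: v).
pose dF (s : R) := 'D_v g (p + t *: w + s *: v) - 'D_v g (p + s *: v).
have FdF s : s \in `[0, t]%R -> is_derive s 1 F (dF s).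
  rewrite in_itv /= => /norm_le [h1 h2].
  by apply: is_deriveB; apply: is_derive_line; rewrite -?addrA; exact: Dg.
have [s sI Fs] := @MVT_segment _ F dF 0 t (ltW t0) (fun s h => FdF s (subset_itv_oo_cc h))
  (@derivable_within_continuous _ _ _ _ (fun s h => @ex_derive _ _ _ _ _ _ _ (FdF s h))).
have -> : second_difference g p v w t = dF s * t.
  rewrite -[t in RHS]subr0 -Fs /F /second_difference !scale0r !addr0; ring.
move: sI; rewrite in_itv /= => /norm_le [h1 h2].
have := DDg _ h1; have := DDg _ h2; rewrite (deriveE _ ddg) /dF addrA.
have -> : 'd ('D_v g) p (t *: w + s *: v) =
    t * 'd ('D_v g) p w + s * 'd ('D_v g) p v by rewrite linearD !linearZ.
have -> : 'd ('D_v g) p (s *: v) = s * 'd ('D_v g) p v by rewrite linearZ.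
set a := 'D_v g (p + _ + _); set b := 'D_v g (p + _).
move: a b ('d _ _ w) ('d _ _ v) ('D_v g p) => a b x y z /ler_normlP[] A1 A2.
move=> /ler_normlP[] B1 B2.
have -> : e * t ^+ 2 = t * (e1 * (t * M) + e1 * (t * M)).
  by rewrite /e1; field; rewrite gt_eqF.
have -> : (a - b) * t - t ^+ 2 * x = t * (a - b - t * x) by ring.
rewrite normrM gtr0_norm// ler_pM2l//.
by apply/ler_normlP; split; lra.
Unshelve. all: by end_near. Qed.

(* The second derivatives need not be continuous, which spares discussing those
   of the composition of the cost with [T]. *)
Lemma deriveC g p v w :
  (\forall q \near p, differentiable g q) ->
  differentiable ('D_v g) p -> differentiable ('D_w g) p ->
  'D_v ('D_w g) p = 'D_w ('D_v g) p.
Proof.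
move=> dg dv dw; apply/eqP; rewrite eq_sym -subr_eq0 -normr_le0.
apply/ler_addgt0Pr => e e0; rewrite add0r.
have e2 : 0 < e / 2 by rewrite divr_gt0.
have H1 := second_difference_derive w dg dv e2.
have H2 := second_difference_derive v dg dw e2.
(* For small [t], both derivatives times [t ^+ 2] lie within [e / 2 * t ^+ 2] of the same second
   difference. *)
near (0 : R)^'+ => t.
have t0 : 0 < t by near: t; exact: nbhs_right_gt.
have := near H1 t; have := near H2 t => /(_ _)/wrap[]//.
rewrite second_differenceC; move=> A /(_ _)/wrap[]//; move: A.
move: (second_difference _ _ _ _ _) ('D_v ('D_w g) p) ('D_w ('D_v g) p).
move=> s x y A B; rewrite -(@ler_pM2l _ (t ^+ 2)) ?exprn_gt0//.
rewrite -[X in X * `|_|]gtr0_norm ?exprn_gt0// -normrM.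
move: A B => /ler_normlP[] A1 A2 /ler_normlP[] B1 B2.
by apply/ler_normlP; split; lra.
Unshelve. all: by end_near. Qed.

End Schwarz.

(** * Components of pair-valued maps *)

Section Products.
Context {R : realType} {V W : normedModType R}.

Lemma near_open (T : topologicalType) (U : set T) (P : T -> Prop) (p : T) :
  open U -> U p -> (forall q, U q -> P q) -> \forall q \near p, P q.
Proof.
by move=> oU Up UP; apply: filterS UP _; exact: open_nbhs_nbhs.
Qed.

Lemma differentiable_fst (p : V * W) : differentiable (@fst V W) p.
Proof. by apply: linear_differentiable => q; exact: cvg_fst. Qed.

Lemma differentiable_snd (p : V * W) : differentiable (@snd V W) p.
Proof. by apply: linear_differentiable => q; exact: cvg_snd. Qed.

Context {X : normedModType R} (f : X -> V * W) (p : X).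
Hypothesis df : differentiable f p.

Lemma differentiable_comp_fst : differentiable (fun q => (f q).1) p.
Proof. exact: differentiable_comp df (differentiable_fst _). Qed.

Lemma differentiable_comp_snd : differentiable (fun q => (f q).2) p.
Proof. exact: differentiable_comp df (differentiable_snd _). Qed.

Lemma derive_fst v : 'D_v (fun q => (f q).1) p = ('D_v f p).1.
Proof.
rewrite deriveE; last exact: differentiable_comp_fst.
rewrite (diff_comp df (differentiable_fst _))/= diff_lin ?deriveE//.
by move=> q; exact: cvg_fst.
Qed.

Lemma derive_snd v : 'D_v (fun q => (f q).2) p = ('D_v f p).2.
Proof.
rewrite deriveE; last exact: differentiable_comp_snd.
rewrite (diff_comp df (differentiable_snd _))/= diff_lin ?deriveE//.
by move=> q; exact: cvg_snd.
Qed.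

End Products.

Section Directions.
Context {R : realType} {V W : normedModType R}.

(** Horizontal and vertical vectors turn the partial derivatives [D1] and [D2] into directional
    derivatives on the product, where Schwarz's theorem applies. *)
Definition hor (u : V) : V * W := (u, 0).

Definition ver (w : W) : V * W := (0, w).

Lemma hor_ver (X : V * W) : X = hor X.1 + ver X.2.
Proof. by case: X => X1 X2; congr pair; rewrite /= ?addr0 ?add0r. Qed.

Lemma hor_linear : linear hor.
Proof. by move=> a u v; congr pair; rewrite /= scaler0 add0r. Qed.

Lemma ver_linear : linear ver.
Proof. by move=> a u v; congr pair; rewrite /= scaler0 add0r. Qed.

End Directions.

(** * Bilinear forms depending on a point *)

Section VariableForms.
Context {R : realType} {n : nat}.
Notation E := 'rV[R]_n.

Lemma scalar_sum (l : E -> R) (v : E) : scalar l ->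
  l v = \sum_i v 0 i * l (delta_mx 0 i).
Proof.
move=> lin; pose lM := GRing.isLinear.Build _ _ _ _ _ lin.
pose lL : {scalar E} := HB.pack l lM.
rewrite -[l]/(lL : E -> R) {1}(row_sum_delta v) linear_sum.
by apply: eq_bigr => i _; rewrite (scalarZ lL).
Qed.

Lemma derive_coord (V : normedModType R) (a : V -> E) (p v : V) i :
  differentiable a p -> 'D_v (fun q => a q 0 i) p = 'D_v a p 0 i.
Proof. by move=> da; rewrite derive_mx ?mxE//; exact: diff_derivable. Qed.

Context {V : normedModType R}.
Variables (L : V -> E -> R) (p : V).
Hypothesis L_scalar : \forall q \near p, scalar (L q).
Hypothesis L_diff : forall v, differentiable (L ^~ v) p.

(** Expansion in the standard basis reduces the moving form at a moving vector to a finite sum of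
    products of real functions. The two agree near [p], where [L q] is linear. *)
Let expand (a : V -> E) : V -> R :=
  \sum_(i < n) ((fun q => a q 0 i) * (L ^~ (delta_mx 0 i))).

Let expandE (a : V -> E) : \forall q \near p, expand a q = L q (a q).
Proof.
near=> q; rewrite scalar_sum; last exact: (near L_scalar q).
by rewrite /expand fct_sumE.
Unshelve. all: by end_near. Qed.

Let coord_diff (a : V -> E) i :
  differentiable a p -> differentiable (fun q => a q 0 i) p.
Proof.
move=> da; apply: (@differentiable_comp _ _ _ _ a (fun M : E => M 0 i)) => //.
exact: differentiable_coord.
Qed.

Lemma differentiable_form (a : V -> E) :
  differentiable a p -> differentiable (fun q => L q (a q)) p.
Proof.
move=> da; apply: (near_eq_differentiable (expandE a)).
by apply: differentiable_sum => i; apply: differentiableM => //; exact: coord_diff.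
Qed.

Let derive_expand (a : V -> E) X : differentiable a p ->
  'D_X (fun q => L q (a q)) p =
    \sum_(i < n) a p 0 i * 'D_X (L ^~ (delta_mx 0 i)) p + L p ('D_X a p).
Proof.
move=> da; rewrite -(near_eq_derive _ (expandE a)) derive_sum; last first.
  move=> i; apply: diff_derivable; apply: differentiableM => //.
  exact: coord_diff.
rewrite (scalar_sum _ (nbhs_singleton L_scalar)) -big_split/=.
apply: eq_bigr => i _; rewrite deriveM;
  [|exact/diff_derivable/coord_diff|exact/diff_derivable].
by rewrite derive_coord// [X in _ + X]mulrC.
Qed.

Let form0 : L p 0 = 0.
Proof.
rewrite (scalar_sum _ (nbhs_singleton L_scalar)) big1// => i _.
by rewrite mxE mul0r.
Qed.

Lemma derive_form (a : V -> E) X : differentiable a p ->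
  'D_X (fun q => L q (a q)) p = 'D_X (L ^~ (a p)) p + L p ('D_X a p).
Proof.
(* The expansion for the constant map [a p] identifies the coordinate sum with the derivative of the
   form at a fixed vector. *)
move=> da; rewrite derive_expand// (derive_expand X (a := cst (a p)))//.
rewrite derive_cst -addrA; congr (_ + _).
by rewrite form0 add0r.
Qed.

(** Makes the right-hand sides of the equations defining the Christoffel functions linear forms,
    hence representable by vectors. *)
Lemma derive_form_scalar X : scalar (fun v => 'D_X (L ^~ v) p).
Proof.
move=> k u v; rewrite !(derive_expand X (a := cst _))//= !derive_cst.
rewrite form0 !addr0 mulr_sumr -big_split/=; apply: eq_bigr => i _.
by rewrite !mxE mulrDl mulrA.
Qed.

End VariableForms.

(** * Nondegenerate bilinear forms and their Gram matrices *)

Section Representation.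
Context {R : realType} {n : nat}.
Notation E := 'rV[R]_n.

Lemma mul_form_matrix (B : E -> E -> R) (u : E) j : (forall z, scalar (B ^~ z)) ->
  (u *m \matrix_(i, j) B (delta_mx 0 i) (delta_mx 0 j)) 0 j = B u (delta_mx 0 j).
Proof.
move=> Bl; rewrite (scalar_sum u (Bl _)) mxE.
by apply: eq_bigr => i _; rewrite mxE.
Qed.

Lemma form_matrix (B : E -> E -> R) (u w : E) :
  (forall z, scalar (B ^~ z)) -> (forall z, scalar (B z)) ->
  B u w = \sum_j (u *m \matrix_(i, j) B (delta_mx 0 i) (delta_mx 0 j)) 0 j * w 0 j.
Proof.
move=> Bl Br; rewrite (scalar_sum w (Br u)); apply: eq_bigr => j _.
by rewrite mulrC mul_form_matrix.
Qed.

(** Each row of the kernel of the Gram matrix is a vector [u] with [B u] identically zero. So the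
    kernel vanishes, and the matrix is square. *)
Lemma nondegenerate_unitmx (B : E -> E -> R) :
  (forall z, scalar (B ^~ z)) -> (forall z, scalar (B z)) ->
  (forall u, (forall w, B u w = 0) -> u = 0) ->
  \matrix_(i, j) B (delta_mx 0 i) (delta_mx 0 j) \in unitmx.
Proof.
move=> Bl Br Bn; rewrite -row_free_unit -kermx_eq0; apply/eqP/row_matrixP => i.
rewrite row0; apply: Bn => w; rewrite form_matrix// -row_mul mulmx_ker.
by rewrite big1// => j _; rewrite !mxE mul0r.
Qed.

Lemma nondegenerate_representation (B : E -> E -> R) (l : E -> R) :
  (forall z, scalar (B ^~ z)) -> (forall z, scalar (B z)) ->
  (forall u, (forall w, B u w = 0) -> u = 0) -> scalar l ->
  exists v, forall w, B v w = l w.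
Proof.
move=> Bl Br Bn ll; have Bu := nondegenerate_unitmx Bl Br Bn.
exists (\row_j l (delta_mx 0 j) *m invmx (\matrix_(i, j) B (delta_mx 0 i) (delta_mx 0 j))).
move=> w; rewrite form_matrix// mulmxKV// (scalar_sum w ll).
by apply: eq_bigr => j _; rewrite mxE mulrC.
Qed.

End Representation.

(** * Levi-Civita connection of a split metric *)

Section SplitMetric.
Context {R : realType} {n : nat}.
Notation E := 'rV[R]_n.

Lemma linear_formB (l : E -> R) u v : scalar l -> l (u - v) = l u - l v.
Proof. by move=> ll; rewrite addrC -scaleN1r ll mulN1r addrC. Qed.

(* Abstracts the mixed Hessian [b p u w = D1 u (D2 w f) p.1 p.2] of a cost [f];
   the last two fields express the symmetry of the third derivatives of [f]. *)
Record split_form (U : set (E * E)) (b : E * E -> E -> E -> R) : Prop := SplitForm {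
  split_left : forall p, U p -> forall w, scalar (b p ^~ w) ;
  split_right : forall p, U p -> forall u, scalar (b p u) ;
  split_diff : forall p, U p -> forall u w, differentiable (fun q => b q u w) p ;
  split_nondeg_left : forall p, U p -> forall u, (forall w, b p u w = 0) -> u = 0 ;
  split_nondeg_right : forall p, U p -> forall w, (forall u, b p u w = 0) -> w = 0 ;
  split_sym_left : forall p, U p -> forall u1 u2 w,
    'D_(hor u1) (fun q => b q u2 w) p = 'D_(hor u2) (fun q => b q u1 w) p ;
  split_sym_right : forall p, U p -> forall u w1 w2,
    'D_(ver w1) (fun q => b q u w2) p = 'D_(ver w2) (fun q => b q u w1) p }.

(** The Kim-McCann metric with both second derivatives expressed by the one form [b]. *)
Definition split_metric (b : E * E -> E -> E -> R) (p u v : E * E) : R :=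
  - 2^-1 * (b p u.1 v.2 + b p v.1 u.2).

(** [get] yields a total function. On [U], nondegeneracy makes the set a singleton; off [U] nothing
    is claimed of the value. *)
Definition left_christoffel (b : E * E -> E -> E -> R) p u1 u2 : E :=
  get [set v | forall w, b p v w = 'D_(hor u1) (fun q => b q u2 w) p].

Definition right_christoffel (b : E * E -> E -> E -> R) p w1 w2 : E :=
  get [set v | forall u, b p u v = 'D_(ver w1) (fun q => b q u w2) p].

Definition split_christoffel b (p u v : E * E) : E * E :=
  (left_christoffel b p u.1 v.1, right_christoffel b p u.2 v.2).

Context (U : set (E * E)) (b : E * E -> E -> E -> R).
Hypotheses (U_open : open U) (bU : split_form U b).

Lemma split_left_inj p : U p -> forall u v,
  (forall w, b p u w = b p v w) -> u = v.
Proof.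
move=> Up u v uv; apply/subr0_eq/(split_nondeg_left bU Up) => w.
by rewrite (linear_formB _ _ (split_left bU Up w)) uv subrr.
Qed.

Lemma split_right_inj p : U p -> forall u v,
  (forall w, b p w u = b p w v) -> u = v.
Proof.
move=> Up u v uv; apply/subr0_eq/(split_nondeg_right bU Up) => w.
by rewrite (linear_formB _ _ (split_right bU Up w)) uv subrr.
Qed.

Lemma derive_split_left p X w : U p -> scalar (fun u => 'D_X (fun q => b q u w) p).
Proof.
move=> Up; apply: (@derive_form_scalar _ _ _ (fun q u => b q u w)).
  by apply: near_open Up _ => // q Uq; exact: (split_left bU Uq).
by move=> u; exact: (split_diff bU Up).
Qed.

Lemma derive_split_right p X u : U p -> scalar (fun w => 'D_X (fun q => b q u w) p).
Proof.
move=> Up; apply: (@derive_form_scalar _ _ _ (fun q w => b q u w)).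
  by apply: near_open Up _ => // q Uq; exact: (split_right bU Uq).
by move=> w; exact: (split_diff bU Up).
Qed.

Lemma left_christoffelE p u1 u2 w : U p ->
  b p (left_christoffel b p u1 u2) w = 'D_(hor u1) (fun q => b q u2 w) p.
Proof.
move=> Up; move: w.
have [v bv] := nondegenerate_representation (split_left bU Up)
  (split_right bU Up) (split_nondeg_left bU Up) (derive_split_right (hor u1) u2 Up).
exact: (getI (P := [set v | forall w, b p v w = 'D_(hor u1) (fun q => b q u2 w) p]) bv).
Qed.

Lemma right_christoffelE p u w1 w2 : U p ->
  b p u (right_christoffel b p w1 w2) = 'D_(ver w1) (fun q => b q u w2) p.
Proof.
move=> Up; move: u.
(* Transposing [b] turns nondegeneracy on the right into nondegeneracy on the left. *)
have [v bv] := nondegenerate_representation (B := fun w u => b p u w)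
  (split_right bU Up) (split_left bU Up) (split_nondeg_right bU Up)
  (derive_split_left (ver w1) w2 Up).
exact: (getI (P := [set v | forall u, b p u v = 'D_(ver w1) (fun q => b q u w2) p]) bv).
Qed.

Lemma left_christoffelP p u1 u2 v : U p ->
  v = left_christoffel b p u1 u2 <->
  forall w, b p v w = 'D_(hor u1) (fun q => b q u2 w) p.
Proof.
move=> Up; split=> [-> w|bv]; first exact: left_christoffelE.
by apply: (split_left_inj Up) => w; rewrite left_christoffelE.
Qed.

Lemma right_christoffelP p w1 w2 v : U p ->
  v = right_christoffel b p w1 w2 <->
  forall u, b p u v = 'D_(ver w1) (fun q => b q u w2) p.
Proof.
move=> Up; split=> [-> u|bv]; first exact: right_christoffelE.
by apply: (split_right_inj Up) => u; rewrite right_christoffelE.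
Qed.

(** Symmetry of third derivatives makes the defining equation symmetric in [u1] and [u2]; this is
    the source of the vanishing torsion. *)
Lemma left_christoffelC p u1 u2 : U p ->
  left_christoffel b p u1 u2 = left_christoffel b p u2 u1.
Proof.
by move=> Up; apply/left_christoffelP => // w; rewrite left_christoffelE// (split_sym_left bU).
Qed.

Lemma right_christoffelC p w1 w2 : U p ->
  right_christoffel b p w1 w2 = right_christoffel b p w2 w1.
Proof.
by move=> Up; apply/right_christoffelP => // u; rewrite right_christoffelE// (split_sym_right bU).
Qed.

Lemma left_christoffel_linear p u : U p -> linear (left_christoffel b p u).
Proof.
move=> Up a v v'; apply/esym/left_christoffelP => // w.
by rewrite (split_left bU Up) !left_christoffelE// -derive_split_left.
Qed.

Lemma right_christoffel_linear p u : U p -> linear (right_christoffel b p u).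
Proof.
move=> Up a v v'; apply/esym/right_christoffelP => // w.
by rewrite (split_right bU Up) !right_christoffelE// -derive_split_right.
Qed.

Lemma split_connection : is_connection U (split_christoffel b).
Proof.
move=> p Up; have GC v w : split_christoffel b p v w = split_christoffel b p w v.
  by congr pair; [exact: left_christoffelC|exact: right_christoffelC].
have lin u : linear (split_christoffel b p u).
  move=> a v v'; rewrite /split_christoffel/=.
  by rewrite left_christoffel_linear// right_christoffel_linear.
split; last exact: lin.
(* Symmetry carries linearity over from the second argument to the first. *)
by move=> w a v v'; rewrite (GC _ w) (GC v) (GC v') lin.
Qed.

Lemma split_torsion_free : torsion_free U (split_christoffel b).
Proof.
move=> X Y _ _ p Up; rewrite /covariant_derivative /lie_bracket.
have -> : split_christoffel b p (Y p) (X p) = split_christoffel b p (X p) (Y p).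
  by congr pair; [exact: left_christoffelC|exact: right_christoffelC].
have addrKB (x y z : E * E) : x + z - (y + z) = x - y.
  by rewrite opprD addrACA subrr addr0.
exact: addrKB.
Qed.

(** The product rule in both slots leaves the derivative of [b] at fixed vectors. Its horizontal
    part is absorbed by the left Christoffel vector, its vertical part by the right one. *)
Lemma derive_split p X (Y Z : E * E -> E) : U p ->
  differentiable Y p -> differentiable Z p ->
  differentiable (fun q => b q (Y q) (Z q)) p /\
  'D_X (fun q => b q (Y q) (Z q)) p =
    b p ('D_X Y p + left_christoffel b p X.1 (Y p)) (Z p) +
    b p (Y p) ('D_X Z p + right_christoffel b p X.2 (Z p)).
Proof.
move=> Up dY dZ.
have nl w : \forall q \near p, scalar (b q ^~ w).
  by apply: near_open Up _ => // q Uq; exact: (split_left bU Uq).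
have nr : \forall q \near p, scalar (b q (Y q)).
  by apply: near_open Up _ => // q Uq; exact: (split_right bU Uq).
have dl w : forall u, differentiable (fun q => b q u w) p.
  by move=> u; exact: (split_diff bU Up).
have dr w : differentiable (fun q => b q (Y q) w) p.
  exact: (differentiable_form (L := fun q u => b q u w)).
split; first exact: (differentiable_form (L := fun q w => b q (Y q) w)).
rewrite (derive_form (L := fun q w => b q (Y q) w))//.
rewrite (derive_form (L := fun q u => b q u (Z p)))//.
rewrite {1}(hor_ver X).
rewrite deriveD_dir; last exact: (split_diff bU Up).
rewrite -left_christoffelE// -right_christoffelE//.
have addl u v w : b p (u + v) w = b p u w + b p v w.
  by have := split_left bU Up w 1 u v; rewrite scale1r mul1r.
have addrr u v w : b p u (v + w) = b p u v + b p u w.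
  by have := split_right bU Up u 1 v w; rewrite scale1r mul1r.
by rewrite addl addrr; ring.
Qed.

(** The metric pairs the first component of each field with the second component of the other, so
    [derive_split] is used once for each pairing. *)
Lemma split_metric_compatible : metric_compatible U (split_metric b) (split_christoffel b).
Proof.
move=> X Y Z VX VY VZ p Up; rewrite /split_metric /covariant_derivative/=.
have [YX [dY ZX]] := (VY p Up, (VZ p Up, VX p Up)).
have [D1 E1] := derive_split (X p) Up (differentiable_comp_fst YX)
  (differentiable_comp_snd dY).
have [D2 E2] := derive_split (X p) Up (differentiable_comp_fst dY)
  (differentiable_comp_snd YX).
have := deriveZ (- 2^-1) (diff_derivable (v := X p) (differentiableD D1 D2)).
rewrite (deriveD (diff_derivable D1) (diff_derivable D2)) E1 E2 => DE.
rewrite [LHS]DE !(derive_fst YX, derive_fst dY, derive_snd YX, derive_snd dY).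
by rewrite [LHS]mulrDr [RHS]addrC; ring.
Qed.

Theorem split_levi_civita : levi_civita U (split_metric b) (split_christoffel b).
Proof.
split; [exact: split_connection|exact: split_torsion_free|exact: split_metric_compatible].
Qed.

(* Koszul's formula for constant vector fields, whose brackets vanish. *)
Lemma levi_civita_koszul G p u v w : levi_civita U (split_metric b) G -> U p ->
  2 * split_metric b p (G p u v) w =
    'D_u (fun q => split_metric b q v w) p + 'D_v (fun q => split_metric b q u w) p
    - 'D_w (fun q => split_metric b q u v) p.
Proof.
move=> [_ tf mc] Up.
have cstU (z : E * E) : vector_field U (cst z) by move=> q _; exact: differentiable_cst.
have GC z z' : G p z z' = G p z' z.
  have := tf _ _ (cstU z) (cstU z') p Up.
  rewrite /covariant_derivative /lie_bracket !derive_cst/= !add0r oppr0.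
  by move/subr0_eq.
have gC z z' : split_metric b p z z' = split_metric b p z' z.
  by rewrite /split_metric addrC.
have K x y z : 'D_x (fun q => split_metric b q y z) p =
    split_metric b p (G p x y) z + split_metric b p y (G p x z).
  have := mc _ _ _ (cstU x) (cstU y) (cstU z) p Up.
  by rewrite /covariant_derivative !derive_cst/= !add0r.
(* Of the six terms, four cancel by symmetry of [G] and of the metric; the other two are equal. *)
rewrite !K (GC v u) (GC w u) (GC w v) (gC v) (gC u (G p v w)); ring.
Qed.

(** Testing against vertical vectors recovers the first component, against horizontal vectors the
    second. *)
Lemma split_metric_nondegenerate p u v : U p ->
  (forall w, split_metric b p u w = split_metric b p v w) -> u = v.
Proof.
move=> Up uv; have b0l w : b p 0 w = 0.
  by have := split_left bU Up w (-1) 0 0; rewrite scaler0 addr0 mulN1r addNr.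
have b0r w : b p w 0 = 0.
  by have := split_right bU Up w (-1) 0 0; rewrite scaler0 addr0 mulN1r addNr.
have h : - 2^-1 != 0 :> R by rewrite oppr_eq0 invr_eq0.
case: u v uv => u1 u2 [v1 v2] uv; congr pair.
  apply: (split_left_inj Up) => w; apply: (mulfI h).
  by have := uv (0, w); rewrite /split_metric/= !b0l !addr0.
apply: (split_right_inj Up) => w; apply: (mulfI h).
by have := uv (w, 0); rewrite /split_metric/= !b0r !add0r.
Qed.

(** Koszul's formula has the same right-hand side for both connections. *)
Theorem split_levi_civita_unique G p u v :
  levi_civita U (split_metric b) G -> U p -> G p u v = split_christoffel b p u v.
Proof.
move=> GL Up; apply: (split_metric_nondegenerate Up) => w.
have h : 2 != 0 :> R by [].
by apply: (mulfI h); rewrite !levi_civita_koszul//; exact: split_levi_civita.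
Qed.

End SplitMetric.

Lemma levi_civita_ext (R : realType) (V : normedModType R) (U : set V)
    (g g' : V -> V -> V -> R) (G : V -> V -> V -> V) :
  open U -> (forall p, U p -> g p = g' p) -> levi_civita U g G ->
  levi_civita U g' G.
Proof.
move=> oU gg' [GC GT GM]; split=> // X Y Z VX VY VZ p Up.
rewrite -gg'// -GM//; apply: near_eq_derive.
by apply: near_open Up _ => // q Uq; rewrite gg'.
Qed.

(** * The mixed Hessian of a cost *)

Section Slices.
Context {R : realType} {V W Z : normedModType R}.

(** The two difference quotients coincide as functions of the step. *)
Lemma derive_slice1 (F : V * W -> Z) x y u :
  'D_(hor u) F (x, y) = 'D_u (fun z => F (z, y)) x.
Proof.
rewrite /derive; set g1 := fun h => h^-1 *: _; set g2 := fun h => h^-1 *: _.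
suff -> : g1 = g2 by [].
apply/funext => h; rewrite /hor /ver /g1 /g2/=.
by congr (_ *: (F (_, _) - _)); rewrite /= scaler0 add0r.
Qed.

Lemma derive_slice2 (F : V * W -> Z) x y w :
  'D_(ver w) F (x, y) = 'D_w (fun z => F (x, z)) y.
Proof.
rewrite /derive; set g1 := fun h => h^-1 *: _; set g2 := fun h => h^-1 *: _.
suff -> : g1 = g2 by [].
apply/funext => h; rewrite /hor /ver /g1 /g2/=.
by congr (_ *: (F (_, _) - _)); rewrite /= scaler0 add0r.
Qed.

Lemma D1E (f : V -> W -> Z) u :
  (fun p => D1 u f p.1 p.2) = 'D_(hor u) (fun p => f p.1 p.2).
Proof. by apply/funext => -[x y]; rewrite derive_slice1. Qed.

Lemma D2E (f : V -> W -> Z) w :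
  (fun p => D2 w f p.1 p.2) = 'D_(ver w) (fun p => f p.1 p.2).
Proof. by apply/funext => -[x y]; rewrite derive_slice2. Qed.

Lemma derive_graph (F : V * W -> Z) (T : V -> W) x v :
  differentiable F (x, T x) -> differentiable T x ->
  'D_v (fun z => F (z, T z)) x = 'D_(v, 'D_v T x) F (x, T x).
Proof.
move=> dF dT; have dg := differentiable_pair (@ex_diff _ _ _ _ _ _ _ (is_diff_id x)) dT.
rewrite deriveE; last exact: (differentiable_comp dg dF).
rewrite (diff_comp dg dF)/= diff_pair// deriveE// deriveE//.
by rewrite (@diff_val _ _ _ _ _ _ _ (is_diff_id x)).
Qed.

Lemma derive_slice_comp (X : normedModType R) (F : V * W -> Z) (T : X -> W) x y w :
  differentiable F (x, T y) -> differentiable T y ->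
  'D_w (fun z => F (x, T z)) y = 'D_(ver ('D_w T y)) F (x, T y).
Proof.
move=> dF dT; have dg := differentiable_pair (differentiable_cst x y) dT.
rewrite deriveE; last exact: (differentiable_comp dg dF).
by rewrite (diff_comp dg dF)/= diff_pair// diff_cst deriveE// deriveE.
Qed.

End Slices.

Section MixedForm.
Context {R : realType} {n : nat}.
Notation E := 'rV[R]_n.

Definition mixed_form (f : E -> E -> R) (p : E * E) (u w : E) : R :=
  D1 u (D2 w f) p.1 p.2.

Lemma mixed_form_derive f u w :
  (fun p => mixed_form f p u w) = 'D_(hor u) ('D_(ver w) (fun p => f p.1 p.2)).
Proof.
rewrite /mixed_form; transitivity ('D_(hor u) (fun p => D2 w f p.1 p.2)).
  exact: (D1E (D2 w f) u).
by apply: (congr1 (fun g => 'D_(hor u) g)); exact: (D2E f w).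
Qed.

Lemma mixed_formE f p u w :
  mixed_form f p u w = 'D_(hor u) ('D_(ver w) (fun p => f p.1 p.2)) p.
Proof. exact: (congr1 (fun g => g p) (mixed_form_derive f u w)). Qed.

Lemma D2D1E (f : E -> E -> R) x y u w :
  D2 w (D1 u f) x y = 'D_(ver w) ('D_(hor u) (fun p => f p.1 p.2)) (x, y).
Proof.
transitivity ('D_(ver w) (fun p => D1 u f p.1 p.2) (x, y)).
  exact: (congr1 (fun g => g (x, y)) (D2E (D1 u f) w)).
by apply: (congr1 (fun g => 'D_(ver w) g (x, y))); exact: (D1E f u).
Qed.

Context (N : set (E * E)) (f : E -> E -> R).
Hypotheses (N_open : open N) (f_smooth : Ck 3 N (fun p => f p.1 p.2)).
Local Notation F := (fun p : E * E => f p.1 p.2).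

Lemma cost_differentiable p : N p -> differentiable F p.
Proof. by case: f_smooth => d _; exact: d. Qed.

Lemma cost_differentiable1 p v : N p -> differentiable ('D_v F) p.
Proof. by case: f_smooth => _ /(_ v)[d _]; exact: d. Qed.

Lemma cost_differentiable2 p v w : N p -> differentiable ('D_w ('D_v F)) p.
Proof. by case: f_smooth => _ /(_ v)[_ /(_ w)[d _]]; exact: d. Qed.

Lemma cost_deriveC p v w : N p -> 'D_v ('D_w F) p = 'D_w ('D_v F) p.
Proof.
move=> Np; apply: deriveC; [|exact: cost_differentiable1|exact: cost_differentiable1].
by apply: (near_open N_open Np) => q; exact: cost_differentiable.
Qed.

Lemma cost_deriveC2 p z v w : N p ->
  'D_v ('D_w ('D_z F)) p = 'D_w ('D_v ('D_z F)) p.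
Proof.
move=> Np; apply: deriveC; [|exact: cost_differentiable2|exact: cost_differentiable2].
by apply: (near_open N_open Np) => q; exact: cost_differentiable1.
Qed.

Lemma mixed_formC p u w : N p ->
  mixed_form f p u w = 'D_(ver w) ('D_(hor u) F) p.
Proof.
move=> Np; by rewrite mixed_formE; exact: cost_deriveC.
Qed.

Lemma differentiable_mixed_form p u w :
  N p -> differentiable (fun q => mixed_form f q u w) p.
Proof.
by move=> Np; rewrite (mixed_form_derive f u w); exact: cost_differentiable2.
Qed.

Lemma derive1_mixed_form X p u w :
  'D_X (fun q => mixed_form f q u w) p = 'D_X ('D_(hor u) ('D_(ver w) F)) p.
Proof. exact: (congr1 (fun g => 'D_X g p) (mixed_form_derive f u w)). Qed.

Lemma derive2_mixed_form X p u w : N p ->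
  'D_X (fun q => mixed_form f q u w) p = 'D_X ('D_(ver w) ('D_(hor u) F)) p.
Proof.
move=> Np; apply: near_eq_derive.
by apply: (near_open N_open Np) => q Nq; exact: mixed_formC.
Qed.

(** Linearity in each argument is that of a differential, once Schwarz's theorem has put the
    matching derivative outermost. The two symmetry fields exchange the outer two of three
    derivatives. *)
Lemma mixed_form_split : Defs.nondegenerate N f -> split_form N (mixed_form f).
Proof.
move=> ndg; split.
- move=> p Np w a u v.
  rewrite !mixed_formE.
  have dp := cost_differentiable1 (ver w) Np.
  by rewrite hor_linear !(deriveE _ dp) linearD linearZ.
- move=> p Np u a v w; rewrite !mixed_formC//.
  have dp := cost_differentiable1 (hor u) Np.
  by rewrite ver_linear !(deriveE _ dp) linearD linearZ.
- by move=> p Np u w; exact: differentiable_mixed_form.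
- move=> [x y] Np u u0; apply: (ndg x y Np).1 => w.
  by rewrite D2D1E -mixed_formC.
- move=> [x y] Np w w0; apply: (ndg x y Np).2 => u.
  by rewrite D2D1E -mixed_formC.
- move=> p Np u1 u2 w; apply: (etrans (derive1_mixed_form _ p u2 w)).
  apply: etrans (esym (derive1_mixed_form _ p u1 w)); exact: cost_deriveC2.
- move=> p Np u w1 w2; apply: (etrans (derive2_mixed_form _ u w2 Np)).
  apply: etrans (esym (derive2_mixed_form _ u w1 Np)); exact: cost_deriveC2.
Qed.

Lemma derive_grad2 u x y : N (x, y) ->
  D1 u (grad2 f) x y = \row_j mixed_form f (x, y) u (delta_mx 0 j).
Proof.
move=> Nxy.
have gE j : (fun z => grad2 f z y 0 j) = (fun z => D2 (delta_mx 0 j) f z y).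
  by apply/funext => z; rewrite mxE.
rewrite {1}/D1 derive_mx.
  apply/rowP => j; rewrite [LHS]mxE [RHS]mxE.
  exact: (congr1 (fun g => 'D_u g x) (gE j)).
apply/derivable_mxP => i j; rewrite ord1 gE; apply: diff_derivable.
have dxy : differentiable (fun z : E => (z, y)) x.
  exact: differentiable_pair _ (differentiable_cst _ _).
apply: (differentiable_comp dxy (g := fun p => D2 (delta_mx 0 j) f p.1 p.2)).
by rewrite (D2E f); exact: cost_differentiable1.
Qed.

Lemma derive2_grad2 u1 u2 x y : N (x, y) ->
  D1 u1 (D1 u2 (grad2 f)) x y =
    \row_j 'D_(hor u1) (fun p => mixed_form f p u2 (delta_mx 0 j)) (x, y).
Proof.
move=> Nxy; have dxy : differentiable (fun z : E => (z, y)) x.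
  exact: differentiable_pair _ (differentiable_cst _ _).
have nearN : \forall z \near x, N (z, y).
  exact: differentiable_continuous dxy _ (open_nbhs_nbhs (conj N_open Nxy)).
pose M (z : E) : E := \row_j mixed_form f (z, y) u2 (delta_mx 0 j).
have ME : \forall z \near x, D1 u2 (grad2 f) z y = M z.
  by apply: filterS nearN => z; exact: derive_grad2.
have gE j : (fun z => M z 0 j) = (fun z => mixed_form f (z, y) u2 (delta_mx 0 j)).
  by apply/funext => z; rewrite mxE.
apply: (etrans (near_eq_derive u1 ME)); rewrite derive_mx.
  apply/rowP => j; rewrite [LHS]mxE [RHS]mxE derive_slice1.
  exact: (congr1 (fun g => 'D_u1 g x) (gE j)).
apply/derivable_mxP => i j; rewrite ord1 gE; apply: diff_derivable.
apply: (differentiable_comp dxy (g := fun p => mixed_form f p u2 (delta_mx 0 j))).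
exact: differentiable_mixed_form.
Qed.

(** Identifies the operator of the final formula with a Gram matrix, which the nondegeneracy of the
    cost makes invertible. *)
Lemma cross_mxE x y : N (x, y) ->
  cross_mx f x y = \matrix_(i, j) mixed_form f (x, y) (delta_mx 0 i) (delta_mx 0 j).
Proof. by move=> Nxy; apply/matrixP => i j; rewrite !mxE derive_grad2// mxE. Qed.

End MixedForm.

(** * The mixed Hessian of the divergence *)

Section Pullback.
Context {R : realType} {n : nat}.
Notation E := 'rV[R]_n.

(** Written out, instead of [mixed_form] of the divergence: [T] and [phi] are only assumed [C^2], so
    the lemmas on [C^3] costs do not apply to the divergence. *)
Definition pullback_form (f : E -> E -> R) (T : E -> E) (p : E * E) (u w : E) : R :=
  mixed_form f (p.1, T p.2) u ('D_w T p.2).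

Context (Om : set E) (N : set (E * E)) (f : E -> E -> R) (phi : E -> R) (T : E -> E).
Hypotheses (Om_open : open Om) (N_open : open N) (Nh_open : open (Nhat Om N T)).
Hypothesis f_smooth : Ck 3 N (fun p => f p.1 p.2).
Hypothesis f_nondeg : Defs.nondegenerate N f.
Hypothesis phi_smooth : Ck 2 Om phi.
Hypothesis T_smooth : Ck 2 Om T.
Hypothesis T_inj : forall x, Om x -> forall w, 'D_w T x = 0 -> w = 0.
Hypothesis T_surj : forall x, Om x -> forall v, exists w, 'D_w T x = v.
Hypothesis T_graph : forall x, Om x -> N (x, T x).
Local Notation F := (fun p : E * E => f p.1 p.2).
Local Notation Phi := (fun p : E * E => (p.1, T p.2)).
Local Notation Nh := (Nhat Om N T).

Lemma map_differentiable x : Om x -> differentiable T x.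
Proof. by case: T_smooth => d _; exact: d. Qed.

Lemma map_differentiable1 w x : Om x -> differentiable ('D_w T) x.
Proof. by case: T_smooth => _ /(_ w)[d _]; exact: d. Qed.

Lemma map_derive_linear x : Om x -> linear (fun w => 'D_w T x).
Proof.
move=> Ox a u v; have dT := map_differentiable Ox.
by rewrite !(deriveE _ dT) linearD linearZ.
Qed.

Lemma Phi_differentiable p : Nh p -> differentiable Phi p.
Proof.
move=> [_ [Op2 _]]; apply: differentiable_pair; first exact: differentiable_fst.
apply: (differentiable_comp (g := T)); first exact: differentiable_snd.
exact: map_differentiable.
Qed.

Lemma Phi_in p : Nh p -> N (Phi p).
Proof. by case=> _ []. Qed.

(** Horizontal motion fixes [p.2], so ['D_w T p.2] is a constant vector. *)
Lemma pullback_form_hor p u v w : Nh p ->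
  'D_(hor u) (fun q => pullback_form f T q v w) p =
  'D_(hor u) (fun q => mixed_form f q v ('D_w T p.2)) (Phi p).
Proof.
case: p => x x' _; apply: (etrans (derive_slice1 _ x x' u)).
exact: esym (derive_slice1 _ x (T x') u).
Qed.

(** Exhibits the form as a vertical derivative, so that Schwarz's theorem can give its symmetry in
    the vertical directions. *)
Lemma derive_Phi_ver p u w : Nh p ->
  'D_(ver w) (fun q => 'D_(hor u) F (Phi q)) p = pullback_form f T p u w.
Proof.
case: p => x x' Np; have [_ [/= Ox' NTx']] := Np.
rewrite derive_slice2/=.
have dF := cost_differentiable1 f_smooth (hor u) NTx'.
rewrite (derive_slice_comp w dF (map_differentiable Ox')).
by rewrite /pullback_form (mixed_formC N_open f_smooth _ _ NTx').
Qed.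

Lemma derive_pullback_ver p u w1 w2 : Nh p ->
  'D_(ver w1) (fun q => pullback_form f T q u w2) p =
  'D_(ver w1) ('D_(ver w2) (fun q => 'D_(hor u) F (Phi q))) p.
Proof.
move=> Np; apply: near_eq_derive; apply: (near_open Nh_open Np) => q Nq.
exact: esym (derive_Phi_ver u w2 Nq).
Qed.

Lemma pullback_form_differentiable p u w : Nh p ->
  differentiable (fun q => pullback_form f T q u w) p.
Proof.
move=> Np; have fS := mixed_form_split N_open f_smooth f_nondeg.
apply: (@differentiable_form _ _ _ (fun q v => mixed_form f (Phi q) u v) p _ _
  (fun q => 'D_w T q.2)).
- apply: (near_open Nh_open Np) => q Nq.
  exact: (split_right fS (Phi_in Nq) u).
- move=> v; apply: (differentiable_comp (Phi_differentiable Np)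
    (g := fun q => mixed_form f q u v)).
  exact: (split_diff fS (Phi_in Np)).
- case: Np => _ [Op2 _].
  apply: (differentiable_comp (differentiable_snd p) (g := 'D_w T)).
  exact: map_differentiable1.
Qed.

Lemma pullback_form_split : split_form Nh (pullback_form f T).
Proof.
have fS := mixed_form_split N_open f_smooth f_nondeg.
split.
- by move=> p Np w; exact: (split_left fS (Phi_in Np)).
- move=> p Np u a v w; rewrite /pullback_form map_derive_linear; last by case: Np => _ [].
  exact: (split_right fS (Phi_in Np)).
- by move=> p Np u w; exact: pullback_form_differentiable.
(* The derivative of [T] is onto, so its values ['D_w T p.2] already test against every [v]. *)
- move=> p Np u u0; apply: (split_nondeg_left fS (Phi_in Np)) => v.
  have [_ [Op2 _]] := Np; have [w <-] := T_surj Op2 v; exact: u0.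
- move=> p Np w w0; have [_ [Op2 _]] := Np; apply: (T_inj Op2).
  exact: (split_nondeg_right fS (Phi_in Np)).
- move=> p Np u1 u2 w; apply: (etrans (pullback_form_hor u1 u2 w Np)).
  apply: etrans (esym (pullback_form_hor u2 u1 w Np)).
  exact: (split_sym_left fS (Phi_in Np)).
(* [deriveC] is applied to ['D_(hor u) F] composed with [Phi]; [dver] gives the differentiability of
   its vertical derivatives. *)
- move=> p Np u w1 w2; apply: (etrans (derive_pullback_ver u w1 w2 Np)).
  apply: etrans (esym (derive_pullback_ver u w2 w1 Np)).
  have dver w q : Nh q ->
      differentiable ('D_(ver w) (fun q => 'D_(hor u) F (Phi q))) q.
    move=> Nq; apply: near_eq_differentiable (pullback_form_differentiable u w Nq).
    apply: (near_open Nh_open Nq) => q' Nq'; exact: esym (derive_Phi_ver u w Nq').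
  apply: deriveC; [|exact: dver|exact: dver].
  apply: (near_open Nh_open Np) => q Nq.
  apply: (differentiable_comp (Phi_differentiable Nq) (g := 'D_(hor u) F)).
  exact: (cost_differentiable1 f_smooth _ (Phi_in Nq)).
Qed.

Local Notation Dv := (fun x x' => f x (T x') + phi x - f x' (T x') - phi x').

Lemma potential_differentiable x : Om x -> differentiable phi x.
Proof. by case: phi_smooth => d _; exact: d. Qed.

Lemma potential_differentiable1 v x : Om x -> differentiable ('D_v phi) x.
Proof. by case: phi_smooth => _ /(_ v)[d _]; exact: d. Qed.

Lemma near_slice1 x x' : Nh (x, x') -> \forall z \near x, Nh (z, x').
Proof.
move=> Np; have dx : differentiable (fun z : E => (z, x')) x.
  exact: differentiable_pair _ (differentiable_cst _ _).
exact: differentiable_continuous dx _ (open_nbhs_nbhs (conj Nh_open Np)).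
Qed.

Lemma near_slice2 x x' : Nh (x, x') -> \forall z \near x', Nh (x, z).
Proof.
move=> Np; have dx : differentiable (fun z : E => (x, z)) x'.
  exact: differentiable_pair (differentiable_cst _ _) _.
exact: differentiable_continuous dx _ (open_nbhs_nbhs (conj Nh_open Np)).
Qed.

Lemma slice1_differentiable (G : E * E -> R) x y :
  differentiable G (x, y) -> differentiable (fun z => G (z, y)) x.
Proof.
move=> dG; apply: (differentiable_comp (f := fun z : E => (z, y)) _ dG).
exact: differentiable_pair _ (differentiable_cst _ _).
Qed.

Lemma slice2_differentiable (G : E * E -> R) x x' : Om x' ->
  differentiable G (x, T x') -> differentiable (fun z => G (x, T z)) x'.
Proof.
move=> Ox' dG; apply: (differentiable_comp (f := fun z : E => (x, T z)) _ dG).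
by apply: differentiable_pair (differentiable_cst _ _) _; exact: map_differentiable.
Qed.

Lemma graph_differentiable (G : E * E -> R) x : Om x ->
  differentiable G (x, T x) -> differentiable (fun z => G (z, T z)) x.
Proof.
move=> Ox dG; apply: (differentiable_comp (f := fun z : E => (z, T z)) _ dG).
by apply: differentiable_pair => //; exact: map_differentiable.
Qed.

Lemma D1D2_divergence p u w : Nh p ->
  D1 u (D2 w Dv) p.1 p.2 = pullback_form f T p u w.
Proof.
case: p => x x' Np /=; have [/= Ox [Ox' Nx]] := Np.
(* [K] collects the terms in [x'] alone; it is constant in [x], so the derivative along [u] removes
   it. *)
pose K := 'D_w (fun z => F (z, T z) + phi z) x'.
have D2Dv : \forall z \near x,
    D2 w Dv z x' = 'D_(ver ('D_w T x')) F (z, T x') - K.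
  apply: filterS (near_slice1 Np) => z [/= Oz [_ Nz]].
  have dF := slice2_differentiable Ox' (cost_differentiable f_smooth Nz).
  have dK : differentiable (fun z => F (z, T z) + phi z) x'.
    apply: (differentiableD (graph_differentiable Ox'
      (cost_differentiable f_smooth (T_graph Ox')))).
    exact: potential_differentiable.
  rewrite -(derive_slice_comp w (cost_differentiable f_smooth Nz) (map_differentiable Ox')).
  rewrite /D2 -(deriveB (diff_derivable dF) (diff_derivable dK)).
  apply: etrans (_ : _ = 'D_w ((fun z' => F (z, T z')) -
    (fun z => F (z, T z) + phi z) + cst (phi z)) x') _.
    apply: (congr1 (fun g => 'D_w g x')); apply/funext => z'; rewrite !fctE /=.
    by ring.
  rewrite (deriveD (diff_derivable (differentiableB dF dK)) (derivable_cst (phi z) x' w)).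
  by rewrite derive_cst addr0.
rewrite {1}/D1; apply: (etrans (near_eq_derive u D2Dv)).
have dG := cost_differentiable1 f_smooth (ver ('D_w T x')) Nx.
have dG1 := diff_derivable (v := u) (slice1_differentiable dG).
apply: (etrans (deriveB dG1 (derivable_cst K x u))).
rewrite derive_cst subr0.
apply: (etrans (esym (derive_slice1 ('D_(ver ('D_w T x')) F) x (T x') u))).
exact: esym (mixed_formE f (x, T x') u ('D_w T x')).
Qed.

Lemma D1_divergence u x x' : Nh (x, x') ->
  D1 u Dv x x' = 'D_(hor u) F (x, T x') + 'D_u phi x.
Proof.
move=> [/= Ox [Ox' Nx]].
have dF := slice1_differentiable (cost_differentiable f_smooth Nx).
have dp := potential_differentiable Ox.
rewrite derive_slice1 -(deriveD (diff_derivable dF) (diff_derivable dp)).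
rewrite /D1; apply: etrans (_ : _ = 'D_u ((fun z => F (z, T x')) + phi +
    cst (- f x' (T x') - phi x')) x) _.
  by apply: (congr1 (fun g => 'D_u g x)); apply/funext => z; rewrite !fctE /= !addrA.
rewrite (deriveD (diff_derivable (differentiableD dF dp)) (derivable_cst _ x u)).
by rewrite derive_cst addr0.
Qed.

(** The second summand of the Kim-McCann metric and the dual connection differentiate in this order.
    Schwarz's theorem is used on the cost, not on the divergence. *)
Lemma D2D1_divergence p u w : Nh p ->
  D2 w (D1 u Dv) p.1 p.2 = pullback_form f T p u w.
Proof.
case: p => x x' Np /=; have [/= Ox [Ox' Nx]] := Np.
have D1Dv : \forall z \near x',
    D1 u Dv x z = 'D_(hor u) F (x, T z) + 'D_u phi x.
  by apply: filterS (near_slice2 Np) => z; exact: D1_divergence.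
rewrite {1}/D2; apply: (etrans (near_eq_derive w D1Dv)).
have dG := cost_differentiable1 f_smooth (hor u) Nx.
have dG2 := diff_derivable (v := w) (slice2_differentiable Ox' dG).
apply: (etrans (deriveD dG2 (derivable_cst ('D_u phi x) x' w))).
rewrite derive_cst addr0 (derive_slice_comp w dG (map_differentiable Ox')).
by rewrite /pullback_form (mixed_formC N_open f_smooth _ _ Nx).
Qed.

Lemma kim_mccann_divergence p : Nh p ->
  kim_mccann Dv p = split_metric (pullback_form f T) p.
Proof.
move=> Np; apply/funext => u; apply/funext => v.
have E1 := D1D2_divergence u.1 v.2 Np; have E2 := D2D1_divergence v.1 u.2 Np.
exact: (congr1 (fun t => - 2^-1 * t) (congr2 (fun s t => s + t) E1 E2)).
Qed.

Lemma D1D1D2_divergence u1 u2 w x x' : Nh (x, x') ->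
  D1 u1 (D1 u2 (D2 w Dv)) x x' =
  'D_(hor u1) (fun q => pullback_form f T q u2 w) (x, x').
Proof.
move=> Np; rewrite derive_slice1; apply: near_eq_derive.
by apply: filterS (near_slice1 Np) => z Nz; exact: (D1D2_divergence u2 w Nz).
Qed.

Lemma D2D2D1_divergence w1 w2 u x x' : Nh (x, x') ->
  D2 w1 (D2 w2 (D1 u Dv)) x x' =
  'D_(ver w1) (fun q => pullback_form f T q u w2) (x, x').
Proof.
move=> Np; rewrite derive_slice2; apply: near_eq_derive.
by apply: filterS (near_slice2 Np) => z Nz; exact: (D2D1_divergence u w2 Nz).
Qed.

Hypothesis first_order : forall x u, Om x -> 'D_(hor u) F (x, T x) = - 'D_u phi x.

Lemma Nhat_diag x : Om x -> Nh (x, x).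
Proof. by move=> Ox; split=> //; split=> //; exact: T_graph. Qed.

(** The right-hand side is minus the c-Hessian of [phi], as a bilinear form. Differentiating
    [first_order] along the graph of [T] produces the form as the vertical part. *)
Lemma pullback_form_diag x u w : Om x ->
  pullback_form f T (x, x) u w =
  - 'D_w ('D_u phi) x - 'D_(hor w) ('D_(hor u) F) (x, T x).
Proof.
move=> Ox; have Nx := T_graph Ox.
have dG := cost_differentiable1 f_smooth (hor u) Nx.
have E1 : 'D_w (fun z => 'D_(hor u) F (z, T z)) x = - 'D_w ('D_u phi) x.
  have dp := diff_derivable (v := w) (potential_differentiable1 u Ox).
  apply: etrans (deriveN dp); apply: near_eq_derive.
  by apply: (near_open Om_open Ox) => z; exact: first_order.
apply: etrans (congr1 (fun t => t - 'D_(hor w) ('D_(hor u) F) (x, T x)) E1).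
rewrite (derive_graph w dG (map_differentiable Ox)) (hor_ver (w, _))/=.
rewrite (deriveD_dir _ _ dG) addrAC subrr add0r.
exact: (mixed_formC N_open f_smooth _ _ Nx).
Qed.

Lemma pullback_form_diagC x u w : Om x ->
  pullback_form f T (x, x) u w = pullback_form f T (x, x) w u.
Proof.
move=> Ox; apply: (etrans (pullback_form_diag u w Ox)).
apply: etrans (esym (pullback_form_diag w u Ox)).
have E1 : 'D_w ('D_u phi) x = 'D_u ('D_w phi) x.
  apply: deriveC; [|exact: potential_differentiable1|exact: potential_differentiable1].
  by apply: (near_open Om_open Ox) => z; exact: potential_differentiable.
have E2 := cost_deriveC N_open f_smooth (hor w) (hor u) (T_graph Ox).
exact: (congr2 (fun s t => - s - t) E1 E2).
Qed.

End Pullback.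

(** * Optimal maps *)

Section FirstOrder.
Context {R : realType}.

(** Restriction to the line through [x] along [u] reduces this to Fermat's theorem in one
    variable. *)
Lemma derive_local_max (V : normedModType R) (g : V -> R) (x u : V) :
  (\forall z \near x, differentiable g z /\ g z <= g x) -> 'D_u g x = 0.
Proof.
move=> gx; pose l (t : R) := x + t *: u.
have dl : differentiable l 0 := @ex_diff _ _ _ _ _ _ _ (is_diff_line x u 0).
have l0 : l 0 = x by rewrite /l scale0r addr0.
have cl : \forall t \near 0, differentiable g (l t) /\ g (l t) <= g x.
  have gl0 : \forall z \near l 0, differentiable g z /\ g z <= g x by rewrite l0.
  exact: differentiable_continuous dl _ gl0.
have /nbhs_ballP[d /= d0 ld] := cl.
have dI (t : R) : t \in `]- d, d[%R -> ball 0 d t.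
  by rewrite in_itv/= -ltr_norml -ball_normE/= sub0r normrN.
have line (t : R) : t \in `]- d, d[%R ->
    is_derive t 1 (fun s => g (l s)) ('D_u g (l t)).
  by move=> /dI/ld[dg _]; exact: is_derive_line.
have I0 : 0 \in `]- d, d[%R by rewrite in_itv/= oppr_lt0 d0.
have dd : - d <= d by rewrite ge0_cp// ltW.
have := derive1_at_max dd (fun t tI => @ex_derive _ _ _ _ _ _ _ (line t tI)) I0.
have := @derive_val _ _ _ _ _ _ _ (line 0 I0); rewrite l0 => <- max0.
apply: derive_val; apply: max0 => t /dI/ld[_]; exact.
Qed.

Lemma derive_left_inverse (V W : normedModType R) (f : V -> W) (g : W -> V) x v :
  (\forall z \near x, g (f z) = z) ->
  differentiable f x -> differentiable g (f x) -> 'D_('D_v f x) g (f x) = v.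
Proof.
move=> gf df dg; rewrite (deriveE _ dg) (deriveE _ df).
rewrite -[LHS]/(('d g (f x) \o 'd f x) v) -(diff_comp df dg).
rewrite -deriveE; last exact: differentiable_comp.
by apply: etrans (derive_id x v); exact: near_eq_derive.
Qed.

(** The derivative of the inverse map inverts that of [f]: the chain rule on [g] after [f] gives
    injectivity, on [f] after [g] surjectivity. *)
Lemma diffeo_derive (V W : normedModType R) k (A : set V) (B : set W) (f : V -> W) x :
  open A -> open B -> Ck_diffeo k.+1 A B f -> A x ->
  injective (fun v => 'D_v f x) /\ forall w, exists v, 'D_v f x = w.
Proof.
move=> oA oB [g [fA gB [df _] [dg _]]] Ax.
have [Bfx gfx] := fA x Ax; have dfx := df x Ax; have dgx := dg _ Bfx.
split=> [|w].
  apply: (can_inj (g := fun w => 'D_w g (f x))) => v.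
  by apply: derive_left_inverse => //; apply: (near_open oA Ax) => z /fA[].
exists ('D_w g (f x)); have := @derive_left_inverse _ _ g f (f x) w.
rewrite gfx; apply=> //.
by apply: (near_open oB Bfx) => z /gB[].
Qed.

Context {n : nat}.
Notation E := 'rV[R]_n.

(** Since [S (T x) = x], the point [x] is the maximizer belonging to [T x]. Openness of [N] keeps
    the cost finite near [x], so the extended-real supremum yields a local maximum of a
    differentiable real function. *)
Lemma optimal_map_first_order (Om Omb : set E) (N : set (E * E))
    (c : E -> E -> \bar R) (phi : E -> R) (T : E -> E) x u :
  open N -> N `<=` Om `*` Omb ->
  (forall x y, N (x, y) -> c x y \is a fin_num) ->
  (forall p, N p -> differentiable (fun p => fcost c p.1 p.2) p) ->
  (forall x, Om x -> differentiable phi x) ->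
  optimal_map Om Omb c phi T -> Om x -> N (x, T x) ->
  'D_(hor u) (fun p => fcost c p.1 p.2) (x, T x) = - 'D_u phi x.
Proof.
move=> oN Nsub cfin dF dphi [S [Smax ST _]] Ox Nx.
have [Oy Sx] := ST x Ox; have [_ maxx] := (Smax _ Oy x).2 (esym Sx).
pose F := fun p : E * E => fcost c p.1 p.2.
have dx : differentiable (fun z : E => (z, T x)) x.
  exact: differentiable_pair _ (differentiable_cst _ _).
have nearN : \forall z \near x, N (z, T x).
  exact: differentiable_continuous dx _ (open_nbhs_nbhs (conj oN Nx)).
have cE z : N (z, T x) -> c z (T x) = (F (z, T x))%:E.
  by move=> Nz; rewrite /F /fcost fineK//; exact: cfin.
have dFz z : N (z, T x) -> differentiable (fun z => F (z, T x)) z.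
  by move=> Nz; exact: slice1_differentiable (dF _ Nz).
pose h := - ((fun z => F (z, T x)) + phi).
have h0 : 'D_u h x = 0.
  apply: derive_local_max; apply: filterS nearN => z Nz.
  have [/= Oz _] := Nsub _ Nz; split.
    exact: differentiableN (differentiableD (dFz z Nz) (dphi z Oz)).
  have : (- c z (T x) - (phi z)%:E <= - c x (T x) - (phi x)%:E)%E.
    by rewrite maxx; apply: ereal_sup_ubound; exists z.
  by rewrite cE// cE// -!EFinN -!EFinD lee_fin /h !fctE /= !opprD.
have dFx := diff_derivable (v := u) (dFz x Nx).
have dpx := diff_derivable (v := u) (dphi x Ox).
move: h0; rewrite (deriveN (derivableD dFx dpx)) (deriveD dFx dpx).
move=> /eqP; rewrite oppr_eq0 addr_eq0 => /eqP Fphi.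
exact: etrans (derive_slice1 F x (T x) u) Fphi.
Qed.

End FirstOrder.

(** * The Levi-Civita connection of the divergence and its restriction to the diagonal *)

Theorem proposition13 (R : realType) (n : nat)
  (Om Omb : set 'rV[R]_n) (N : set ('rV[R]_n * 'rV[R]_n))
  (c : 'rV[R]_n -> 'rV[R]_n -> \bar R)
  (phi : 'rV[R]_n -> R) (T : 'rV[R]_n -> 'rV[R]_n)
  (Om_domain : domain Om) (Omb_domain : domain Omb)
  (N_open : open N) (N_sub : N `<=` Om `*` Omb)
  (c_adm : admissible_cost Om Omb N c)
  (phi_convex : c_convex Om Omb c phi)
  (T_opt : optimal_map Om Omb c phi T)
  (phi_legendre : c_legendre Om Omb N c phi T)
  (Nhat_open : open (Nhat Om N T)) :
  let Dv := c_divergence c phi T in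
  let KM := kim_mccann Dv in
  (exists G, levi_civita (Nhat Om N T) KM G) /\
  forall G, levi_civita (Nhat Om N T) KM G ->
  exists G1 Gm1 : 'rV[R]_n -> 'rV[R]_n -> 'rV[R]_n -> 'rV[R]_n -> 'rV[R]_n,
    (forall x x', Nhat Om N T (x, x') -> forall u1 u1' u2 u2',
       G (x, x') (u1, u1') (u2, u2') = (G1 x x' u1 u2, Gm1 x x' u1' u2')) /\
    forall x, Om x ->
      [/\ primal_christoffel Dv x (G1 x x),
          dual_christoffel Dv x (Gm1 x x),
          cross_mx (fcost c) x (T x) \in unitmx &
          forall u1 u2, G1 x x u1 u2 =
            D1 u1 (D1 u2 (grad2 (fcost c))) x (T x)
              *m invmx (cross_mx (fcost c) x (T x))].
Proof.
move=> Dv KM.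
have [Om_open _ _] := Om_domain; have [Omb_open _ _] := Omb_domain.
have [_ c_fin c_smooth _ c_nondeg] := c_adm.
have [phi_smooth T_diffeo T_graph _] := phi_legendre.
have T_smooth : Ck 2 Om T by case: T_diffeo => ? [].
have T_inj x : Om x -> forall w, 'D_w T x = 0 -> w = 0.
  move=> Ox w w0; have [inj _] := diffeo_derive Om_open Omb_open T_diffeo Ox.
  by apply: inj; rewrite w0 derive0.
have T_surj x : Om x -> forall v, exists w, 'D_w T x = v.
  by move=> Ox; have [] := diffeo_derive Om_open Omb_open T_diffeo Ox.
have T_first x u : Om x ->
    'D_(hor u) (fun p => fcost c p.1 p.2) (x, T x) = - 'D_u phi x.
  move=> Ox; apply: (optimal_map_first_order u N_open N_sub c_fin _ _ T_opt Ox (T_graph x Ox)).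
    exact: cost_differentiable c_smooth.
  exact: potential_differentiable phi_smooth.
pose b := pullback_form (fcost c) T.
have bS : split_form (Nhat Om N T) b by exact: pullback_form_split.
have KME p : Nhat Om N T p -> KM p = split_metric b p.
  exact: kim_mccann_divergence.
split.
  exists (split_christoffel b).
  apply: (levi_civita_ext Nhat_open) (split_levi_civita Nhat_open bS).
  by move=> p Np; exact: esym (KME p Np).
move=> G /(levi_civita_ext Nhat_open KME) GL.
exists (fun x x' => left_christoffel b (x, x')), (fun x x' => right_christoffel b (x, x')).
split=> [x x' Np u1 u1' u2 u2'|x Ox].
  exact: split_levi_civita_unique GL Np.
have Nxx : Nhat Om N T (x, x) by exact: Nhat_diag.
have Nx := T_graph x Ox.
have fS := mixed_form_split N_open c_smooth c_nondeg.
have D12 u w : D1 u (D2 w Dv) x x = b (x, x) u w.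
  exact: (D1D2_divergence _ _ _ _ _ u w Nxx).
have cross_unit : cross_mx (fcost c) x (T x) \in unitmx.
  rewrite (cross_mxE c_smooth Nx).
  exact: (nondegenerate_unitmx (split_left fS Nx) (split_right fS Nx)
    (split_nondeg_left fS Nx)).
have D112 u1 u2 w : D1 u1 (D1 u2 (D2 w Dv)) x x =
    'D_(hor u1) (fun q => b q u2 w) (x, x).
  exact: (D1D1D2_divergence _ _ _ _ _ u1 u2 w Nxx).
have D221 w1 w2 u : D2 w1 (D2 w2 (D1 u Dv)) x x =
    'D_(ver w1) (fun q => b q u w2) (x, x).
  exact: (D2D2D1_divergence _ _ _ _ _ w1 w2 u Nxx).
split; [| |exact: cross_unit|].
- move=> u1 u2 v; apply: (iff_trans (left_christoffelP Nhat_open bS u1 u2 v Nxx)).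
  rewrite /divergence_metric; split=> bv w.
    exact: (congr1 -%R (etrans (D12 v w) (etrans (bv w) (esym (D112 u1 u2 w))))).
  exact: (etrans (esym (D12 v w)) (etrans (oppr_inj (bv w)) (D112 u1 u2 w))).
- move=> w1 w2 v; apply: (iff_trans (right_christoffelP Nhat_open bS w1 w2 v Nxx)).
  (* The divergence metric has [v] in the first slot of [b], the right Christoffel equation in the
     second; symmetry on the diagonal reconciles them. *)
  have bC u : D1 v (D2 u Dv) x x = b (x, x) u v.
    by apply: (etrans (D12 v u)); exact: (pullback_form_diagC Om_open N_open
      c_smooth phi_smooth T_smooth T_graph T_first v u Ox).
  rewrite /divergence_metric; split=> bv u.
    exact: (congr1 -%R (etrans (bC u) (etrans (bv u) (esym (D221 w1 w2 u))))).
  exact: (etrans (esym (bC u)) (etrans (oppr_inj (bv u)) (D221 w1 w2 u))).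
- move=> u1 u2; set g1 := left_christoffel _ _ _ _.
  rewrite -[LHS](mulmxK cross_unit); congr (_ *m _).
  apply: etrans (esym (derive2_grad2 N_open c_smooth u1 u2 Nx)).
  rewrite (cross_mxE c_smooth Nx); apply/rowP => j.
  (* With this [w], the [j]-th coordinate of the equation for the cost is the Christoffel equation
     of [b] tested at [w]. *)
  have [w wj] := T_surj x Ox (delta_mx 0 j).
  have bg := etrans (left_christoffelE Nhat_open bS u1 u2 w Nxx)
    (pullback_form_hor (fcost c) u1 u2 w Nxx).
  rewrite [LHS](mul_form_matrix _ _ (split_left fS Nx)) [RHS]mxE -wj.
  exact: bg.
Qed.
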